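(* Let $T_1,T_2$ be tree-like spaces such that $T_1$ is a minor of $T_2$. Then the edge tree set $\tau(T_1)$ is isomorphic to a subset of $\tau(T_2)$ (closed under the involution, with the induced order).
   Context: Graph-like space: topological space with vertex set $V$, edge set $E$, underlying set $V\sqcup((0,1)\times E)$, continuous $\iota_e:[0,1]\to G$ with $\iota_e(x)=(x,e)$ on $(0,1)$, end-vertices $\iota_e(0),\iota_e(1)\in V$, $\iota_e|_{(0,1)}$ open, and any two distinct vertices separated by disjoint open sets partitioning $V$. Loop: $\iota_e(0)=\iota_e(1)$. $G-e$ deletes the inner points of $e$. Pseudo-arc from $a$ to $b$: compact connected graph-like space where $a,b$ lie in different components of $P-e$ for every edge $e$. Tree-like space: compact loop-free connected graph-like space $T$ such that $T-e$ is disconnected for every edge $e$; between vertices $u,v$ there is a unique pseudo-arc $P(u,v)$. Edge tree set $\tau(T)$: ground set $\{(\iota_e(0),\iota_e(1)),(\iota_e(1),\iota_e(0)):e\in E(T)\}$, involution $(x,y)^*=(y,x)$, and $(x,y)<(v,w)$ iff $\{x,y\}\neq\{v,w\}$ and $P(y,v)\subseteq P(x,v)\subseteq P(x,w)$. Isomorphism of separation systems: bijection $f$ with $f,f^{-1}$ order-preserving and commuting with the involution. Minors: for $F\subseteq E(G)$, $G-F$ deletes inner points of edges in $F$; $G-W$ deletes a set $W$ of vertices that are end-vertices of no edge. Contraction $G/F$: quotient by the minimal equivalence relation containing $\iota_e(x)\sim\iota_e(y)$ for $e\in F$, $x,y\in[0,1]$, making the quotient Hausdorff; vertices are classes of vertices,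 edges $E(G)\setminus F$. Isomorphism of graph-like spaces: homeomorphism inducing a bijection of vertex sets. $G'$ is a minor of $G$ if $G'\cong((G/F_1)-F_2)-W$ for disjoint $F_1,F_2\subseteq E(G)$ and a set $W$ of non-end-vertices of $(G/F_1)-F_2$.
   Formalization: Graph-like spaces are additionally required to be Hausdorff, since otherwise the pseudo-arc P(u,v) need not be unique (one edge with a further vertex doubling its midpoint), so the edge tree set would be undefined. *)

(* Defs.v *)
From HB Require Import structures.
From mathcomp Require Import all_boot all_order all_algebra generic_quotient.
From mathcomp Require Import all_classical all_reals topology normedtype.

Set Implicit Arguments.
Unset Strict Implicit.
Unset Printing Implicit Defensive.

Import Order.TTheory GRing.Theory Num.Theory.
Import numFieldNormedType.Exports.

Local Open Scope classical_set_scope.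
Local Open Scope ring_scope.
Local Open Scope quotient_scope.

Definition I01 (R : realType) : set R := `[0, 1]%classic.
Arguments I01 R : clear implicits.

Lemma I01_0 (R : realType) : (0 : R) \in I01 R.
Proof. by rewrite inE /I01 /= in_itv /= lexx ler01. Qed.

Lemma I01_1 (R : realType) : (1 : R) \in I01 R.
Proof. by rewrite inE /I01 /= in_itv /= lexx ler01. Qed.

Definition i0 {R : realType} : I01 R := exist _ 0 (I01_0 R).
Definition i1 {R : realType} : I01 R := exist _ 1 (I01_1 R).

(* The open unit interval, as a set of points of [0, 1]. *)
Definition open01 {R : realType} : set (I01 R) :=
  [set t | 0 < set_val t < 1].

(* Raw data of a graph-like space; the axioms are the predicate [graph_like]
   below, so that deletion and contraction are total operations on the data. *)
Record gspace (R : realType) := GSpace {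
  gpt :> topologicalType;
  vtx : set gpt;
  edge : Type;
  iota : edge -> I01 R -> gpt
}.

Arguments vtx {R} g.
Arguments edge {R} g.
Arguments iota {R} g e t.

Definition inner {R : realType} (G : gspace R) (F : set (edge G)) : set G :=
  [set p | exists e t, [/\ F e, open01 t & iota G e t = p]].

(* The fields [gl_cover], [gl_inner] and [gl_inj] say that the underlying set is
   the disjoint union of V and (0,1) x E, the point (t, e) being [iota G e t].
   Hausdorffness is a standing property of graph-like spaces (without it
   G / set0 would differ from G, and pseudo-arcs in tree-like spaces would not
   be unique), but it does not follow from the other fields: take one edge and
   add a third vertex as a second copy of its midpoint (the line with two
   origins). *)
Record graph_like {R : realType} (G : gspace R) : Prop := {
  gl_hausdorff : hausdorff_space G;
  gl_cover : vtx G `|` inner [set: edge G] = [set: G];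
  gl_inner : vtx G `&` inner [set: edge G] = set0;
  gl_inj : forall e e' t t', open01 t -> open01 t' ->
    iota G e t = iota G e' t' -> e = e' /\ t = t';
  gl_cont : forall e, continuous (iota G e);
  gl_end0 : forall e, vtx G (iota G e i0);
  gl_end1 : forall e, vtx G (iota G e i1);
  gl_open : forall e (A : set (I01 R)), open A -> A `<=` open01 ->
    open (iota G e @` A);
  gl_sep : forall u v, vtx G u -> vtx G v -> u <> v ->
    exists U U' : set G, [/\ open U, open U', U `&` U' = set0,
      vtx G `<=` U `|` U' & U u /\ U' v]
}.

Definition end_vertex {R : realType} (G : gspace R) (p : G) : Prop :=
  exists e, p = iota G e i0 \/ p = iota G e i1.

(* The subspace on the set of points S, with the vertices lying in S and the
   edges contained in S together with their end-vertices. *)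
Definition gsub {R : realType} (G : gspace R) (S : set G) : gspace R :=
  @GSpace R (set_type S : topologicalType)
    [set p | vtx G (set_val p)]
    {e : edge G | forall t, S (iota G e t)}
    (fun e t => exist _ (iota G (proj1_sig e) t) (mem_set (proj2_sig e t))).

(* G - F; the remaining edges are those outside F by [del_edgesP]. *)
Definition del_edges {R : realType} (G : gspace R) (F : set (edge G)) :
  gspace R := gsub (~` inner F).

Lemma del_edgesP (R : realType) (G : gspace R) (F : set (edge G)) e :
  graph_like G -> (forall t, (~` inner F) (iota G e t)) <-> ~ F e.
Proof.
move=> hG; split=> [h Fe|nFe t [e' [t' [Fe' t'01 eqp]]]].
  have h2 : (2^-1 : R) \in I01 R.
    by rewrite inE /I01 /= in_itv /= invr_ge0 ler0n invf_le1 ?ltr0n ?ler1n.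
  pose t : I01 R := exist _ 2^-1 h2; case: (h t); exists e, t; split=> //.
  by rewrite /open01 /= set_valE /= invr_gt0 ltr0n invf_lt1 ?ltr0n ?ltr1n.
have inn : inner [set: edge G] (iota G e t) by exists e', t'.
have nv : ~ vtx G (iota G e t).
  by move=> v; have : (vtx G `&` inner [set: edge G]) (iota G e t) by [];
     rewrite (gl_inner hG).
have t01 : open01 t.
  case: t inn nv {eqp} => t ht _ nv.
  have /[!inE] := ht; rewrite /I01 /= in_itv /= => /andP[t0 t1].
  rewrite /open01 /= set_valE /= !lt_neqAle t0 t1 !andbT; apply/andP; split.
    apply/eqP => e0; apply: nv; rewrite (_ : exist _ t ht = i0).
      exact: gl_end0.
    exact/val_inj.
  apply/eqP => e1; apply: nv; rewrite (_ : exist _ t ht = i1).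
    exact: gl_end1.
  exact/val_inj.
by have [ee _] := gl_inj hG t'01 t01 eqp; apply: nFe; rewrite -ee.
Qed.

(* G - W; every edge remains if W contains no end-vertex. *)
Definition del_vertices {R : realType} (G : gspace R) (W : set G) : gspace R :=
  gsub (~` W).

Definition collapsing {R : realType} (G : gspace R) (F : set (edge G))
    (r : equiv_rel G) : Prop :=
  (forall e t t', F e -> r (iota G e t) (iota G e t')) /\
  hausdorff_space (quotient_topology {eq_quot r}).

(* The least collapsing relation: the intersection of all of them. It is itself
   collapsing by [contract_equiv_collapsing]. *)
Definition contract_rel {R : realType} (G : gspace R) (F : set (edge G)) :
  rel G := fun p q => `[< forall r : equiv_rel G, collapsing F r -> r p q >].

Lemma contract_rel_equiv (R : realType) (G : gspace R) (F : set (edge G)) :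
  equiv_class_of (contract_rel F).
Proof.
split.
- by move=> x; apply/asboolP => r _; exact: equiv_refl.
- move=> x y; apply/asboolP/asboolP => h r hr; rewrite equiv_sym; exact: h.
- move=> y x z /asboolP xy /asboolP yz; apply/asboolP => r hr.
  exact: equiv_trans (xy r hr) (yz r hr).
Qed.

Definition contract_equiv {R : realType} (G : gspace R) (F : set (edge G)) :
  equiv_rel G := EquivRelPack (contract_rel_equiv F).

Lemma contract_equiv_collapsing (R : realType) (G : gspace R)
  (F : set (edge G)) : collapsing F (contract_equiv F).
Proof.
split=> [e t t' Fe|]; first by apply/asboolP => r [/(_ e t t' Fe)].
set Q := quotient_topology _; rewrite open_hausdorff => p q pq.
have : ~~ contract_equiv F (repr p) (repr q).
  apply: contra pq => h; rewrite -(reprK p) -(reprK q).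
  by apply/eqP/(@eqmodP _ (contract_equiv F)).
move/asboolPn => /existsNP[r /not_implyP[[rF rH] rpq]].
pose Qr := quotient_topology {eq_quot r}.
pose h : Q -> Qr := (\pi_Qr : G -> Qr) \o repr.
have hpi x y : contract_equiv F x y -> \pi_Qr x = \pi_Qr y.
  by move=> /asboolP /(_ r (conj rF rH)) rxy; apply/(@eqmodP _ r).
have hcont : continuous h.
  apply: (@repr_comp_continuous _ _ Qr (\pi_Qr : G -> Qr)); first exact: pi_continuous.
  by move=> x y /eqP /(@eqmodP _ (contract_equiv F)) xy; apply/eqP/hpi.
have hpq : h p != h q by apply/eqP => /(@eqmodP _ r) /rpq.
move: rH; rewrite open_hausdorff => /(_ _ _ hpq) [[A B] /= [Ap Bq] [oA oB AB]].
exists (h @^-1` A, h @^-1` B) => /=.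
  by move: Ap Bq; rewrite !inE.
move/continuousP: hcont => hcont.
split; [exact: hcont|exact: hcont|].
by rewrite -preimage_setI; move: AB => /eqP ->; rewrite preimage_set0 eqxx.
Qed.

(* G / F *)
Definition contract {R : realType} (G : gspace R) (F : set (edge G)) :
  gspace R :=
  let Q := quotient_topology {eq_quot contract_equiv F} in
  @GSpace R (Q : topologicalType) ((\pi_Q : G -> Q) @` vtx G)
    {e : edge G | ~ F e}
    (fun e t => \pi_Q (iota G (proj1_sig e) t)).

Definition giso {R : realType} (G H : gspace R) : Prop :=
  exists (f : G -> H) (g : H -> G),
    [/\ cancel f g, cancel g f, continuous f, continuous g &
        f @` vtx G = vtx H].

Definition minor {R : realType} (H G : gspace R) : Prop :=
  exists F1 F2 : set (edge G), F1 `&` F2 = set0 /\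
    let G' := del_edges [set e : edge (contract F1) | F2 (proj1_sig e)] in
    exists W : set G', [/\ W `<=` vtx G',
      (forall w, W w -> ~ end_vertex w) & giso H (del_vertices W)].

Definition pseudo_arc {R : realType} (P : gspace R) (a b : P) : Prop :=
  [/\ graph_like P, compact [set: P], connected [set: P], vtx P a /\ vtx P b &
      forall e : edge P, ~ connected_component (~` inner [set e]) a b].

Definition tree_like {R : realType} (T : gspace R) : Prop :=
  [/\ graph_like T, compact [set: T], connected [set: T],
      (forall e, iota T e i0 <> iota T e i1) &
      forall e : edge T, ~ connected (~` inner [set e])].

Definition pseudo_arc_in {R : realType} (T : gspace R) (u v : T) (S : set T) :
  Prop := exists a b : gsub S,
    [/\ set_val a = u, set_val b = v & pseudo_arc a b].

(* P(u, v), the unique pseudo-arc in T between u and v. *)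
Definition parc {R : realType} (T : gspace R) (u v : T) : set T :=
  xget set0 (pseudo_arc_in u v).

(* Data of a separation system: a set with an order and an involution. *)
Record sepsys := SepSys {
  sep :> Type;
  sep_le : sep -> sep -> Prop;
  sep_inv : sep -> sep
}.

Arguments sep_inv {s} x.

Definition inv_closed (S : sepsys) (A : set S) : Prop :=
  forall s, A s -> A (sep_inv s).

Definition subsys (S : sepsys) (A : set S) (hA : inv_closed A) : sepsys :=
  @SepSys {s : S | A s}
    (fun s t => sep_le (proj1_sig s) (proj1_sig t))
    (fun s => exist _ (sep_inv (proj1_sig s)) (hA _ (proj2_sig s))).

Definition sepsys_iso (S S' : sepsys) : Prop :=
  exists (f : S -> S') (g : S' -> S),
    [/\ cancel f g, cancel g f,
        (forall s t, sep_le s t -> sep_le (f s) (f t)),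
        (forall s t, sep_le s t -> sep_le (g s) (g t)) &
        (forall s, f (sep_inv s) = sep_inv (f s)) /\
        (forall s, g (sep_inv s) = sep_inv (g s))].

Definition tau_ground {R : realType} (T : gspace R) : set (T * T) :=
  [set p | exists e, p = (iota T e i0, iota T e i1) \/
                     p = (iota T e i1, iota T e i0)].
Arguments tau_ground {R} T _.

Definition tau_lt {R : realType} (T : gspace R) (p q : T * T) : Prop :=
  [/\ [set p.1; p.2] <> [set q.1; q.2],
      parc p.2 q.1 `<=` parc p.1 q.1 & parc p.1 q.1 `<=` parc p.1 q.2].

Lemma tau_ground_swap (R : realType) (T : gspace R) (p : tau_ground T) :
  ((set_val p).2, (set_val p).1) \in tau_ground T.
Proof.
rewrite set_valE; have /set_mem[e] := valP p.
by case=> -> /=; apply/mem_set; exists e; [right|left].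
Qed.

Definition tau {R : realType} (T : gspace R) : sepsys :=
  @SepSys (tau_ground T)
    (fun p q => p = q \/ tau_lt (set_val p) (set_val q))
    (fun p => exist _ ((set_val p).2, (set_val p).1) (tau_ground_swap p)).

(* Main.v *)
(** An edge [e] of a tree-like space [T] yields a continuous map
    [coord e : T -> R] with [coord e (iota T e t) = t] that sends the two
    components of [T - e] to 0 and 1. The pseudo-arc between vertices [u] and
    [v] is the set of points lying with [u] and [v] on the same side of every
    edge that does not separate [u] from [v], so the order of the edge tree set
    says on which side of [e] the edge [f] lies, and vice versa.

    If [e] is not contracted, the kernel of [coord e] is one of the equivalence
    relations competing in the definition of the contraction. Hence [coord e]
    descends to the contraction, and a minor map transports the sides of [e] to
    the sides of the corresponding edge of the minor. *)

From mathcomp Require Import all_boot all_order all_algebra generic_quotient.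
From mathcomp Require Import all_classical all_reals topology normedtype.
From mathcomp Require Import lra.
Require Import Defs.

Set Implicit Arguments.
Unset Strict Implicit.
Unset Printing Implicit Defensive.

Import Order.TTheory GRing.Theory Num.Theory.
Import numFieldNormedType.Exports.

Local Open Scope classical_set_scope.
Local Open Scope ring_scope.
Local Open Scope quotient_scope.

(** * General topology *)

Section Topology.
Variable T : topologicalType.
Implicit Types A B K P Q U : set T.

Lemma connected_sub_closed A P Q : connected A -> closed P -> closed Q ->
  A `<=` P `|` Q -> A `&` P `&` Q = set0 -> A `&` P !=set0 -> A `<=` P.
Proof.
move=> cA cP cQ APQ dPQ ne; suff <- : A `&` P = A by move=> ? [].
apply: cA => //; last by exists P.
exists (~` Q); first exact: closed_openC.
apply/seteqP; split=> x [Ax]; first by move=> Px; split=> // Qx;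
  have : (A `&` P `&` Q) x by []; rewrite dPQ.
by move=> nQx; split=> //; case: (APQ x Ax).
Qed.

Lemma connected_sub_open A P Q : connected A -> open P -> open Q ->
  A `<=` P `|` Q -> A `&` P `&` Q = set0 -> A `&` P !=set0 -> A `<=` P.
Proof.
move=> cA cP cQ APQ dPQ ne; suff <- : A `&` P = A by move=> ? [].
apply: cA => //; first by exists P.
exists (~` Q); first exact: open_closedC.
apply/seteqP; split=> x [Ax]; first by move=> Px; split=> // Qx;
  have : (A `&` P `&` Q) x by []; rewrite dPQ.
by move=> nQx; split=> //; case: (APQ x Ax).
Qed.

(** Relatively clopen subsets of a closed set are closed in the whole space, so a disconnection
    consists of two disjoint closed sets. *)
Lemma closed_connected A : closed A ->
  (forall P Q, closed P -> closed Q -> P `&` Q = set0 -> A = P `|` Q ->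
     P !=set0 -> Q !=set0 -> False) -> connected A.
Proof.
move=> cA h B B0 [C oC BC] [D cD BD]; apply: contrapT => nBA.
apply: (h B (A `&` ~` C)) => //.
- by rewrite BD; exact: closedI.
- by apply: closedI => //; exact: open_closedC.
- by apply/seteqP; split=> // x []; rewrite {1}BC => -[_ Cx] [].
- by rewrite {1}BC -setIUr setUv setIT.
- apply: contrapT => /set0P/negP/negPn/eqP e0; apply: nBA.
  rewrite BC; apply/seteqP; split=> x; first by case.
  move=> Ax; split=> //; apply: contrapT => nCx.
  by have : (A `&` ~` C) x by []; rewrite e0.
Qed.

(** Otherwise the traces on [K] of the members of [D], with [O] removed, generate a proper filter. A
    cluster point of it lies in [K], in every closed member of [D], and outside [O]. *)
Lemma compact_directed_sub K (D : set (set T)) O :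
  compact K -> D setT -> (forall A B, D A -> D B -> D (A `&` B)) ->
  (forall A, D A -> closed A) -> open O ->
  K `&` \bigcap_(A in D) A `<=` O -> exists2 A, D A & K `&` A `<=` O.
Proof.
move=> cK DT DI Dc oO KDO; apply: contrapT => nex.
pose f A := K `&` A `&` ~` O.
have ff : Filter (filter_from D f).
  apply: filter_from_filter; first by exists setT.
  move=> A B DA DB; exists (A `&` B); first exact: DI.
  by move=> x [[Kx [Ax Bx]] nOx].
have pf : ProperFilter (filter_from D f).
  apply: filter_from_proper => A DA; apply: contrapT => nf; apply: nex.
  exists A => // x [Kx Ax]; apply: contrapT => nOx; apply: nf.
  by exists x.
have [|p [Kp cp]] := cK _ pf; first by exists setT => // x [[]].
have clF A : closed A -> filter_from D f A -> A p.
  by move=> cA FA; apply: cA => B pB; exact: cp.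
have nOp : (~` O) p.
  by apply: clF; [exact: open_closedC|exists setT => // x []].
apply/nOp/KDO; split=> // A DA; apply: clF; first exact: Dc.
by exists A => // x [[]].
Qed.

Lemma connected_set_type (S : set T) (A : set S) :
  connected (set_val @` A) -> connected A.
Proof.
move=> cA B [b Bb] [_ [U oU <-] BU] [C cC BC].
have [V oV VC] : open (~` C) by exact: closed_openC.
have sub : set_val @` A `<=` U.
  apply: (connected_sub_open cA oU oV).
  - move=> _ [a Aa <-]; have [Ca|nCa] := pselect (C a).
      have : B a by rewrite BC.
      by rewrite BU => -[_ ?]; left.
    by right; have : (set_val @^-1` V) a by rewrite VC.
  - apply/seteqP; split=> // x [[[a Aa <-] Ua] Va].
    have : (set_val @^-1` V) a by []. rewrite VC => nCa.
    have : B a by rewrite BU.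
    by rewrite BC => -[].
  - move: Bb; rewrite BU => -[Ab Ub].
    by exists (set_val b); split=> //; exists b.
rewrite BU; apply/seteqP; split=> [x []|x Ax]//; split=> //.
by apply: sub; exists x.
Qed.

Lemma compact_set_type (S : set T) : compact S -> compact [set: S].
Proof.
move=> cS F pF _.
have pfF : ProperFilter (set_val @ F) by exact: fmap_proper_filter.
have [|p [Sp cp]] := cS (set_val @ F) pfF.
  by apply: (@filterS _ F _ setT) filterT => x _; exact: set_valP.
exists (exist _ p (mem_set Sp)); split=> // A B FA [_ [[W oW <-] Wp WB]].
have [||y [Ay Wy]] := cp (set_val @` A) W.
- by apply: (@filterS _ F _ A) FA => x Ax; exists x.
- exact: open_nbhs_nbhs.
by case: Ay Wy => x Ax <- Wx; exists x; split=> //; exact: WB.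
Qed.

Lemma hausdorff_set_type (S : set T) :
  hausdorff_space T -> hausdorff_space (S : topologicalType).
Proof.
rewrite !open_hausdorff => hT x y xy.
have [|[A B] /= [Ax By] [oA oB AB]] := hT (set_val x) (set_val y).
  by apply: contra xy => /eqP /val_inj ->.
exists (set_val @^-1` A, set_val @^-1` B) => /=.
  by move: Ax By; rewrite !inE.
split; [by exists A|by exists B|].
by rewrite -preimage_setI (eqP AB) preimage_set0.
Qed.

Lemma continuous_set_val (S : set T) : continuous (set_val : S -> T).
Proof. exact: initial_continuous. Qed.

Lemma continuous_to_set_type (X : topologicalType) (S : set T) (f : X -> S) :
  continuous (set_val \o f) -> continuous f.
Proof.
move/continuousP => cf; apply/continuousP => _ [U oU <-].
by rewrite -comp_preimage; exact: cf.
Qed.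

(** The image is an interval; if it contained both 0 and 1, it would contain 1/2. *)
Lemma connected_01_const (R : realType) A (f : T -> R) :
  connected A -> continuous f -> (forall x, A x -> f x = 0 \/ f x = 1) ->
  forall x y, A x -> A y -> f x = f y.
Proof.
move=> cA cf f01.
have key x y : A x -> A y -> f x = 0 -> f y = 1 -> False.
  move=> Ax Ay fx fy.
  have : connected (f @` A).
    by apply: connected_continuous_connected => //; exact: continuous_subspaceT.
  move=> /connected_intervalP /(_ 0 1) h.
  have [|||z Az fz] := h _ _ 2^-1; [by exists x|by exists y|lra|].
  by have [] := f01 z Az; rewrite fz => ?; lra.
move=> x y Ax Ay.
have [fx|fx] := f01 x Ax; have [fy|fy] := f01 y Ay; rewrite ?fx ?fy //.
- by case: (key x y).
- by case: (key y x).
Qed.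

End Topology.

(** * The unit interval and graph-like spaces *)

Section UnitInterval.
Variable R : realType.

Lemma I01P (t : I01 R) : 0 <= set_val t <= 1.
Proof. by have := set_valP t; rewrite /I01 /= in_itv. Qed.

Lemma I01_cases (t : I01 R) : [\/ t = i0, t = i1 | open01 t].
Proof.
have /andP[t0 t1] := I01P t.
have [e0|n0] := eqVneq (set_val t) 0; first by apply: Or31; exact/val_inj.
have [e1|n1] := eqVneq (set_val t) 1; first by apply: Or32; exact/val_inj.
by apply: Or33; rewrite /open01 /= !lt_neqAle t0 t1 n1 eq_sym n0.
Qed.

Lemma I01_exists (x : R) : 0 <= x <= 1 -> exists t : I01 R, set_val t = x.
Proof.
move=> x01; have xI : x \in I01 R by rewrite inE /I01 /= in_itv.
by exists (exist _ x xI).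
Qed.

Lemma compact_I01 : compact [set: I01 R].
Proof. exact/compact_set_type/segment_compact. Qed.

Lemma connected_I01 (i : interval R) :
  [set` i] `<=` I01 R -> connected [set t : I01 R | set_val t \in i].
Proof.
move=> iI; apply: connected_set_type.
rewrite (_ : _ @` _ = [set` i]); first exact/connected_intervalP/interval_is_interval.
apply/seteqP; split=> [_ [t ti <-]//|x xi].
by have [t tx] := I01_exists (iI x xi); exists t => //=; rewrite tx.
Qed.

Lemma connected_I01T : connected [set: I01 R].
Proof.
rewrite (_ : setT = [set t : I01 R | set_val t \in `[0, 1]]); first exact: connected_I01.
by apply/seteqP; split=> // t _ /=; rewrite in_itv /=; exact: I01P.
Qed.

Lemma open01E : (open01 : set (I01 R)) = [set t | set_val t \in `]0, 1[].
Proof. by apply/seteqP; split=> t /=; rewrite in_itv. Qed.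

Lemma connected_open01 : connected (open01 : set (I01 R)).
Proof.
rewrite open01E; apply: connected_I01 => x /=; rewrite in_itv /= => /andP[? ?].
by rewrite /I01 /= in_itv /= !ltW.
Qed.

Lemma open_open01 : open (open01 : set (I01 R)).
Proof.
exists `]0, 1[%classic; first exact: itv_open.
by rewrite open01E.
Qed.

Lemma open01_half : exists2 t : I01 R, open01 t & set_val t = 2^-1.
Proof.
have [|t th] := @I01_exists 2^-1; first lra.
by exists t => //; rewrite /open01 /= th; lra.
Qed.

End UnitInterval.

Section GraphLike.
Variables (R : realType) (G : gspace R).
Hypothesis hG : graph_like G.
Implicit Types (e f : edge G) (p : G).

(** Ends are indexed by booleans so that [b%:R] is the coordinate of [eend e b] and negation swaps
    the ends. *)
Definition eend e (b : bool) : G := iota G e (if b then i1 else i0).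

Lemma eend_vtx e b : vtx G (eend e b).
Proof. by case: b; [exact: gl_end1|exact: gl_end0]. Qed.

Lemma vtx_not_inner (F : set (edge G)) p : vtx G p -> ~ inner F p.
Proof.
move=> vp [e [t [_ t01 ep]]].
have : (vtx G `&` inner [set: edge G]) p by split=> //; exists e, t.
by rewrite (gl_inner hG).
Qed.

Lemma not_vtx_inner p : ~ vtx G p -> exists e t, open01 t /\ iota G e t = p.
Proof.
have : [set: G] p by []; rewrite -(gl_cover hG) => -[//|[e [t [_ t01 tp]]] _].
by exists e, t.
Qed.

Lemma innerP e t : inner [set e] (iota G e t) -> open01 t.
Proof.
have [->|->|//] := I01_cases t => /vtx_not_inner []; [exact: gl_end0|exact: gl_end1].
Qed.

Lemma inner_iota e f t : inner [set e] (iota G f t) -> f = e.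
Proof.
move=> i; have [_ h] := @del_edgesP _ _ [set e] f hG.
by apply: contrapT => /h /(_ t).
Qed.

Lemma inner_image e : inner [set e] = iota G e @` open01.
Proof.
apply/seteqP; split=> p; first by move=> [_ [t [-> t01 <-]]]; exists t.
by move=> [t t01 <-]; exists e, t.
Qed.

Lemma open_inner (F : set (edge G)) : open (inner F).
Proof.
rewrite (_ : inner F = \bigcup_(e in F) inner [set e]).
  apply: bigcup_open => e _; rewrite inner_image.
  by apply: gl_open => //; exact: open_open01.
apply/seteqP; split=> p; first by move=> [e [t [Fe t01 <-]]]; exists e => //; exists e, t.
by move=> [e Fe [_ [t [-> t01 <-]]]]; exists e, t.
Qed.

Lemma compact_edge e : compact (range (iota G e)).
Proof.
apply: continuous_compact; last exact: compact_I01.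
by apply: continuous_subspaceT; exact: gl_cont.
Qed.

Lemma closed_edge e : closed (range (iota G e)).
Proof. by apply: compact_closed; [exact: gl_hausdorff|exact: compact_edge]. Qed.

Lemma connected_edge e : connected (range (iota G e)).
Proof.
apply: connected_continuous_connected; first exact: connected_I01T.
by apply: continuous_subspaceT; exact: gl_cont.
Qed.

End GraphLike.

(** * The coordinate of an edge of a tree-like space *)

(** By [ec_conn] the fibres over 0 and 1 are the two components of [T - e]; each contains an end of
    [e]. *)
Record edge_coord (R : realType) (T : gspace R) (e : edge T) (r : T -> R) :
  Prop := EdgeCoord {
  ec_cont : continuous r;
  ec_iota : forall t, r (iota T e t) = set_val t;
  ec_out : forall p, ~ inner [set e] p -> r p = 0 \/ r p = 1;
  ec_conn : forall b : bool, connected [set p | r p = b%:R]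
}.

Section EdgeCoordExists.
Variables (R : realType) (T : gspace R).
Hypothesis hT : tree_like T.
Variable e : edge T.
Local Notation G_e := (~` inner [set e]).

Let hG : graph_like T. Proof. by case: hT. Qed.

Let end_out b : G_e (eend e b).
Proof. by apply: (vtx_not_inner hG); exact: eend_vtx. Qed.

(** With both ends in [P], the whole edge can be added to [P], and the result and [Q] split the
    connected space [T]. *)
Let ends_split (P Q : set T) : closed P -> closed Q -> P `&` Q = set0 ->
  P `|` Q = G_e -> (forall b, P (eend e b)) -> Q !=set0 -> False.
Proof.
move=> cP cQ PQ0 PQ Pe [q Qq].
have cT : connected [set: T] by case: hT.
have disj : [set: T] `&` (P `|` range (iota T e)) `&` Q = set0.
  apply/seteqP; split=> // p [[_ [Pp|[t _ tp]]] Qp].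
    by have : (P `&` Q) p by []; rewrite PQ0.
  have : (P `&` Q) p; last by rewrite PQ0.
  split=> //; have [t0|t1|t01] := I01_cases t.
  - by rewrite -tp t0; exact: (Pe false).
  - by rewrite -tp t1; exact: (Pe true).
  - have : G_e p by rewrite -PQ; right.
    by case; rewrite -tp; exists e, t.
have cPe : closed (P `|` range (iota T e)).
  by apply: closedU => //; exact: closed_edge.
have : [set: T] `<=` P `|` range (iota T e).
  apply: (connected_sub_closed cT cPe cQ _ disj).
    move=> p _; have [|ip] := pselect (G_e p).
      by rewrite -PQ => -[?|?]; [left; left|right].
    left; right; move: ip; rewrite inner_image => /contrapT [t _ <-].
    by exists t.
  by exists (eend e false); split=> //; left.
move=> /(_ q Logic.I) Pq.
suff : ([set: T] `&` (P `|` range (iota T e)) `&` Q) q by rewrite disj.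
by [].
Qed.

(** If [P] split, adding its part at [eend e b] to [Q] would leave a part without ends of [e],
    against [ends_split]. *)
Let side_connected (P Q : set T) b : closed P -> closed Q -> P `&` Q = set0 ->
  P `|` Q = G_e -> P (eend e b) -> Q (eend e (~~ b)) -> connected P.
Proof.
move=> cP cQ PQ0 PQ Pb Qb; apply: closed_connected => // A B cA cB AB0 PAB.
have key A' B' : closed A' -> closed B' -> A' `&` B' = set0 -> P = A' `|` B' ->
    A' (eend e b) -> B' !=set0 -> False.
  move=> cA' cB' AB'0 PAB' A'b; apply: (@ends_split (Q `|` A')) => //.
  - exact: closedU.
  - apply/seteqP; split=> // p [[Qp|A'p] B'p].
      have : (P `&` Q) p by split=> //; rewrite PAB'; right.
      by rewrite PQ0.
    by have : (A' `&` B') p by []; rewrite AB'0.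
  - by rewrite -setUA -PAB' setUC.
  - move=> c; have [->|cb] := eqVneq c b; first by right.
    by left; move: Qb; suff -> : ~~ b = c by []; case: c {Pb A'b} (b) cb => -[].
move=> A0 B0; have : P (eend e b) by [].
rewrite PAB => -[Ab|Bb]; first exact: (key A B).
by apply: (key B A) => //; rewrite ?(setIC B) ?(setUC B).
Qed.

(** By [ends_split], a split of [T - e] into two nonempty closed sets has one end of [e] on each
    side. The coordinate is 0 on one side, 1 on the other, and the parameter along [e]. *)
Lemma edge_coord_exists : exists r, edge_coord e r.
Proof.
have nc : ~ connected G_e by case: hT.
have [P [Q [cP cQ PQ0 PQ [P0 Q1]]]] : exists P Q : set T, [/\ closed P, closed Q,
    P `&` Q = set0, P `|` Q = G_e & P (eend e false) /\ Q (eend e true)].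
  apply: contrapT => nex; apply: nc; apply: closed_connected.
    by apply: open_closedC; exact: open_inner.
  move=> P Q cP cQ PQ0 PQ P0 Q0.
  have QP0 : Q `&` P = set0 by rewrite setIC.
  have QP : Q `|` P = G_e by rewrite setUC.
  have : G_e (eend e true) by exact: end_out.
  have : G_e (eend e false) by exact: end_out.
  rewrite PQ => -[Pf|Qf] [Pt|Qt].
  - by apply: (ends_split cP cQ PQ0 (esym PQ)) => // -[].
  - by apply: nex; exists P, Q.
  - by apply: nex; exists Q, P.
  - by apply: (ends_split cQ cP QP0 QP) => // -[].
have nPQ p : P p -> ~ Q p by move=> Pp Qp; have : (P `&` Q) p by []; rewrite PQ0.
have nPi t : open01 t -> ~ P (iota T e t).
  move=> t01 Pt; have : G_e (iota T e t) by rewrite -PQ; left.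
  by case; exists e, t.
have nQi t : open01 t -> ~ Q (iota T e t).
  move=> t01 Pt; have : G_e (iota T e t) by rewrite -PQ; right.
  by case; exists e, t.
(* Only inner points of [e] reach the last branch; they have a parameter, so the default [i0] is not
   taken. *)
pose r p : R := if `[< P p >] then 0 else if `[< Q p >] then 1
  else set_val (xget i0 [set t | iota T e t = p]).
have rP p : P p -> r p = 0 by move=> Pp; rewrite /r asboolT.
have rQ p : Q p -> r p = 1.
  by move=> Qp; rewrite /r asboolF ?asboolT// => /nPQ.
have rI t : r (iota T e t) = set_val t.
  have [->|->|t01] := I01_cases t; [exact: rP|exact: rQ|].
  rewrite /r asboolF; last exact: nPi.
  rewrite asboolF; last exact: nQi.
  have : iota T e (xget i0 [set t' | iota T e t' = iota T e t]) = iota T e t.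
    by apply: (@xgetPex _ i0 [set t' | iota T e t' = iota T e t]); exists t.
  set t' := xget _ _ => tt'.
  have t'01 : open01 t' by apply: (innerP hG (e := e)); rewrite tt'; exists e, t.
  by have [_ ->] := gl_inj hG t'01 t01 tt'.
have cover p : [\/ P p, Q p | exists2 t, open01 t & p = iota T e t].
  have [|] := pselect (G_e p).
    by rewrite -PQ => -[?|?]; [apply: Or31|apply: Or32].
  by rewrite inner_image => /contrapT [t t01 <-]; apply: Or33; exists t.
exists r; split=> //.
(* The preimage of a closed set is the image of a compact set of parameters, together with [P] if 0
   is in [D] and [Q] if 1 is. *)
- apply/continuous_closedP => D cD.
  rewrite (_ : r @^-1` D = iota T e @` (set_val @^-1` D) `|`
      (P `&` [set _ | D 0]) `|` (Q `&` [set _ | D 1])); last first.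
    apply/seteqP; split=> p /=.
      have [Pp|Qp|[t t01 ->]] := cover p.
      + by rewrite rP// => ?; left; right.
      + by rewrite rQ// => ?; right.
      + by rewrite rI => ?; left; left; exists t.
    move=> [[[t Dt <-]|[Pp D0]]|[Qp D1]].
    + by rewrite rI.
    + by rewrite rP.
    + by rewrite rQ.
  have ccst (X : Prop) : closed [set _ : T | X].
    have [x|nx] := pselect X.
      by rewrite (_ : [set _ | X] = setT); [exact: closedT|apply/seteqP; split].
    by rewrite (_ : [set _ | X] = set0); [exact: closed0|apply/seteqP; split].
  apply: closedU; last exact: closedI.
  apply: closedU; last exact: closedI.
  apply: compact_closed; first exact: gl_hausdorff.
  apply: continuous_compact; first by apply: continuous_subspaceT; exact: gl_cont.
  apply: (subclosed_compact _ (@compact_I01 R)) => //.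
  by move/continuous_closedP: (@continuous_set_val _ (I01 R)); apply.
- move=> p; have [/rP ->|/rQ ->|[t t01 -> []]] := cover p; [by left|by right|].
  by exists e, t.
- case.
  + rewrite (_ : [set _ | _] = Q).
      by apply: (side_connected cQ cP _ _ Q1 P0); rewrite 1?setIC 1?setUC.
    apply/seteqP; split=> p /=; last exact: rQ.
    have [/rP ->|//|[t t01 ->]] := cover p; first by move/eqP; rewrite eq_sym oner_eq0.
    by rewrite rI => t1; move: t01; rewrite /open01 /= t1 ltxx andbF.
  + rewrite (_ : [set _ | _] = P); first exact: (side_connected cP cQ _ _ P0 Q1).
    apply/seteqP; split=> p /=; last exact: rP.
    have [//|/rQ ->|[t t01 ->]] := cover p; first by move/eqP; rewrite oner_eq0.
    by rewrite rI => t1; move: t01; rewrite /open01 /= t1 ltxx.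
Qed.

End EdgeCoordExists.

Lemma natb_inj (R : realType) (b c : bool) : b%:R = c%:R :> R -> b = c.
Proof.
by case: b c => -[]// /eqP; rewrite ?oner_eq0// eq_sym oner_eq0.
Qed.

(** The zero function is only a default; in a tree-like space [coordP] gives a genuine
    coordinate. *)
Definition coord (R : realType) (T : gspace R) (e : edge T) : T -> R :=
  xget (fun=> 0) (edge_coord e).

Section Coord.
Variables (R : realType) (T : gspace R).
Hypothesis hT : tree_like T.
Implicit Types (e f : edge T) (u v p : T) (b c : bool).

Let hG : graph_like T. Proof. by case: hT. Qed.

Lemma coordP e : edge_coord e (coord e).
Proof. by apply: xgetPex; exact: edge_coord_exists. Qed.

Lemma coord_iota e t : coord e (iota T e t) = set_val t.
Proof. exact: ec_iota (coordP e) t. Qed.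

Lemma coord_continuous e : continuous (coord e).
Proof. exact: ec_cont (coordP e). Qed.

Lemma coord_end e b : coord e (eend e b) = b%:R.
Proof. by rewrite /eend coord_iota; case: b. Qed.

Lemma coord_out e p : ~ inner [set e] p -> exists b, coord e p = b%:R.
Proof. by move=> /(ec_out (coordP e)) [->|->]; [exists false|exists true]. Qed.

Lemma coord_vtx e p : vtx T p -> exists b, coord e p = b%:R.
Proof. by move=> vp; apply/coord_out/vtx_not_inner. Qed.

Lemma open01_coord e t b : open01 t -> coord e (iota T e t) <> b%:R.
Proof.
rewrite coord_iota /open01 /= => /andP[t0 t1] tb.
by move: t0 t1; rewrite tb; case: b {tb}; rewrite ltxx.
Qed.

Lemma coord_iota_end e t b :
  coord e (iota T e t) = b%:R -> iota T e t = eend e b.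
Proof.
have [->|->|/open01_coord h /h//] := I01_cases t; rewrite coord_iota.
- by case: b => // /(@natb_inj _ false true).
- by case: b => // /(@natb_inj _ true false).
Qed.

Lemma coord_inner e p : 0 < coord e p < 1 ->
  exists t, [/\ open01 t, p = iota T e t & coord e p = set_val t].
Proof.
move=> p01; have [|/coord_out[b pb]] := pselect (inner [set e] p).
  rewrite inner_image => -[t t01 tp]; exists t; split=> //.
  by rewrite -tp coord_iota.
by move: p01; rewrite pb; case: b {pb}; rewrite ltxx ?andbF.
Qed.

Lemma coord_closed e x : closed [set p | coord e p = x].
Proof.
have /continuous_closedP h := @coord_continuous e.
exact: (h [set x] (@closed_eq _ x)).
Qed.

(** The edge [f] is connected and avoids the inner points of [e], where alone [coord e] differs from
    0 and 1. *)
Lemma coord_const e f t t' : e <> f ->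
  coord e (iota T f t) = coord e (iota T f t').
Proof.
move=> ef; apply: (connected_01_const (@connected_edge _ _ hG f) (@coord_continuous e)).
- move=> _ [s _ <-]; apply: (ec_out (coordP e)) => /(inner_iota hG) fe.
  exact: ef.
- by exists t.
- by exists t'.
Qed.

(** [K] can leave the side [b] only through [eend e b]. In a split of the intersection, a part
    missing this end is thus separated from all the rest of [K]. *)
Lemma connected_side (K : set T) e b : closed K -> connected K ->
  connected (K `&` [set p | coord e p = b%:R]).
Proof.
move=> cK kK; apply: closed_connected; first by apply: closedI => //; exact: coord_closed.
move=> P Q cP cQ PQ0 PQ P0 Q0.
have key P' Q' : closed P' -> closed Q' -> P' `&` Q' = set0 ->
    K `&` [set p | coord e p = b%:R] = P' `|` Q' -> P' !=set0 -> Q' !=set0 ->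
    ~ Q' (eend e b) -> False.
  move=> cP' cQ' PQ'0 PQ' [p P'p] [q Q'q] nQ'.
  (* [N] covers the rest of [K]. On side [b] the edge contributes only its end, which [Q']
     misses. *)
  pose N := P' `|` (range (iota T e) `|` [set p | coord e p = (~~ b)%:R]).
  have sub r : (P' `|` Q') r -> K r /\ coord e r = b%:R by rewrite -PQ'.
  have cN : closed N.
    apply: closedU => //; apply: closedU; [exact: closed_edge|exact: coord_closed].
  have dN : K `&` Q' `&` N = set0.
    apply/seteqP; split=> // r [[Kr Q'r]].
    have [_ rb] := sub r (or_intror Q'r).
    case=> [P'r|]; first by have : (P' `&` Q') r by []; rewrite PQ'0.
    case=> [[t _ tr]|].
      by apply: nQ'; rewrite -(@coord_iota_end e t b) tr.
    by rewrite /= rb => /natb_inj; case: (b).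
  have KQ : K `<=` Q'.
    apply: (connected_sub_closed kK cQ' cN _ dN).
      move=> r Kr; have [[c rc]|nr] := pselect (exists c : bool, coord e r = c%:R).
        have [cb|cb] := eqVneq c b.
          have : (K `&` [set p | coord e p = b%:R]) r by rewrite -cb.
          by rewrite PQ' => -[?|?]; [right; left|left].
        by right; right; right; rewrite /= rc; congr (_%:R); case: (b) (c) cb => -[].
      right; right; left; apply: contrapT => nrg; apply: nr; apply: coord_out.
      by rewrite inner_image => -[t _ tr]; apply: nrg; exists t.
    by exists q; split=> //; case: (sub q (or_intror Q'q)).
  have : (P' `&` Q') p by split=> //; apply: KQ; case: (sub p (or_introl P'p)).
  by rewrite PQ'0.
have [Qb|nQb] := pselect (Q (eend e b)); last exact: (key P Q).
apply: (key Q P) => //; rewrite ?(setIC Q) ?(setUC Q)// => Pb.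
by have : (P `&` Q) (eend e b) by []; rewrite PQ0.
Qed.

(** The candidate for [P(u, v)], identified with [parc u v] in [parcE]; as an intersection of fibres
    it is closed. *)
Definition spine u v : set T :=
  [set p | forall e, coord e u = coord e v -> coord e p = coord e u].

Lemma spine_l u v : spine u v u. Proof. by []. Qed.

Lemma spine_r u v : spine u v v. Proof. by move=> e ->. Qed.

Lemma closed_spine u v : closed (spine u v).
Proof.
rewrite (_ : spine u v = \bigcap_(e in [set e | coord e u = coord e v])
  [set p | coord e p = coord e u]); last by [].
by apply: closed_bigI => e _; exact: coord_closed.
Qed.

Lemma compact_spine u v : compact (spine u v).
Proof.
have cT : compact [set: T] by case: hT.
by apply: (subclosed_compact _ cT) => //; exact: closed_spine.
Qed.

(** Normality extends a split of the spine to disjoint open sets; by compactness their union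
    contains a connected set around the spine, which meets both. *)
Lemma connected_spine u v : vtx T u -> connected (spine u v).
Proof.
move=> vu; have cT : compact [set: T] by case: hT.
have kT : connected [set: T] by case: hT.
apply: closed_connected; first exact: closed_spine.
move=> P Q cP cQ PQ0 PQ [p Pp] [q Qq].
have nT := compact_normal (gl_hausdorff hG) cT.
have /(@normal_openP R) /(_ P Q cP cQ PQ0) [U [V [oU oV PU QV UV0]]] := nT.
(* Testing against every [K], not just against [T], makes [D] stable under intersection. The sides
   belong to it by [connected_side]. *)
pose D := [set A : set T | [/\ closed A, spine u v `<=` A &
  forall K, closed K -> connected K -> connected (K `&` A)]].
have [|A B [cA sA kA] [cB sB kB]|A []//|||A [cA sA kA] AUV] :=
    @compact_directed_sub T setT D (U `|` V) cT.
- by split=> // K _ kK; rewrite setIT.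
- split; [exact: closedI|by move=> x sx; split; [exact: sA|exact: sB]|].
  by move=> K cK kK; rewrite setIA; apply: kB; [exact: closedI|exact: kA].
- exact: openU.
- move=> x [_ Dx]; have : spine u v x.
    move=> e uv; apply: (Dx [set p | coord e p = coord e u]); split.
    + exact: coord_closed.
    + by move=> y; apply.
    + by have [b ->] := coord_vtx e vu => K cK kK; exact: connected_side.
  by rewrite PQ => -[/PU|/QV]; [left|right].
have {}kA : connected A by rewrite -[A]setTI; apply: kA => //; exact: closedT.
have AU : A `<=` U.
  apply: (connected_sub_open kA oU oV).
  - by move=> x Ax; apply: AUV.
  - by rewrite -setIA UV0 setI0.
  - by exists p; split; [apply: sA; rewrite PQ; left|exact: PU].
have : (U `&` V) q; last by rewrite UV0.
by split; [apply/AU/sA; rewrite PQ; right|exact: QV].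
Qed.

(** The coordinate of an inner point is strictly between 0 and 1, that of a vertex is not; so the
    condition of [spine] for [e] must be vacuous. *)
Lemma spine_inner u v e t : vtx T u -> open01 t -> spine u v (iota T e t) ->
  coord e u <> coord e v.
Proof.
move=> vu t01 st uv; have [b ub] := coord_vtx e vu.
by have := st e uv; rewrite ub; exact: open01_coord.
Qed.

(** [e] separates [u] from [v] and imposes no condition; all other coordinates are constant along
    [e]. *)
Lemma spine_edge u v e t t' : vtx T u -> open01 t -> spine u v (iota T e t) ->
  spine u v (iota T e t').
Proof.
move=> vu t01 st f fuv; rewrite -(st f fuv); apply: coord_const => fe.
by move: fuv; rewrite fe; exact: (spine_inner vu t01 st).
Qed.

End Coord.

(** * Pseudo-arcs in tree-like spaces *)

(** An edge with an inner point in [S] has to lie in [S]: otherwise this point would be neither a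
    vertex nor an inner point of [gsub S]. *)
Lemma gsub_graph_like (R : realType) (G : gspace R) (S : set G) :
  graph_like G ->
  (forall e t, open01 t -> S (iota G e t) -> forall t', S (iota G e t')) ->
  graph_like (gsub S).
Proof.
move=> hG hS; split.
- exact: hausdorff_set_type (gl_hausdorff hG).
- apply/seteqP; split=> // p _; have [vp|nvp] := pselect (vtx G (set_val p)).
    by left.
  have [e [t [t01 tp]]] := not_vtx_inner hG nvp.
  have St : S (iota G e t) by rewrite tp; exact: set_valP.
  by right; exists (exist _ e (hS e t t01 St)), t; split=> //; exact: val_inj.
- apply/seteqP; split=> // p [vp [e [t [_ t01 tp]]]].
  apply: (vtx_not_inner hG (F := setT) vp).
  by exists (proj1_sig e), t; split=> //; rewrite -tp.
- move=> [e Se] [f Sf] t t' t01 t'01 /(congr1 set_val) /= h.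
  have [ef tt'] := gl_inj hG t01 t'01 h; split=> //.
  by move: Se {h}; rewrite ef => Se; congr exist; exact: Prop_irrelevance.
- by move=> e; apply: continuous_to_set_type; exact: gl_cont.
- by move=> e; exact: (gl_end0 hG (proj1_sig e)).
- by move=> e; exact: (gl_end1 hG (proj1_sig e)).
- move=> e A oA A01; exists (iota G (proj1_sig e) @` A); first exact: gl_open.
  apply/seteqP; split=> p; last by move=> [t At <-]; exists t.
  by move=> [t At tp]; exists t => //; exact: val_inj.
- move=> u v vu vv uv.
  have [|U [V [oU oV UV0 VUV [Uu Vv]]]] := gl_sep hG vu vv.
    by move=> /val_inj.
  exists (set_val @^-1` U), (set_val @^-1` V); split.
  + by exists U.
  + by exists V.
  + by rewrite -preimage_setI UV0 preimage_set0.
  + by move=> p vp; exact: VUV.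
  + by [].
Qed.

Section PseudoArcs.
Variables (R : realType) (T : gspace R).
Hypothesis hT : tree_like T.
Implicit Types (e f : edge T) (u v p : T) (b c : bool).

Let hG : graph_like T. Proof. by case: hT. Qed.

Lemma spine_pseudo_arc u v : vtx T u -> vtx T v ->
  pseudo_arc_in u v (spine u v).
Proof.
move=> vu vv.
exists (exist _ u (mem_set (@spine_l _ _ u v))).
exists (exist _ v (mem_set (@spine_r _ _ u v))).
split=> //; split=> //.
- by apply: gsub_graph_like => // e t t01 st t'; exact: (spine_edge hT _ _ t01 st).
- exact/compact_set_type/compact_spine.
- apply: connected_set_type; rewrite (_ : _ @` _ = spine u v).
    exact: connected_spine.
  apply/seteqP; split=> [_ [p _ <-]|p sp]; first exact: set_valP.
  by exists (exist _ p (mem_set sp)).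
(* On a connected set [A] avoiding the inner points of [e], [coord e] is constant; but [e], being in
   the spine, separates [u] from [v]. *)
move=> [e se] [A [Au Ae kA] Av].
have [h h01 _] := open01_half R.
apply: (spine_inner hT vu h01 (se h)).
have kA' : connected (set_val @` A).
  apply: connected_continuous_connected => //.
  by apply: continuous_subspaceT; exact: continuous_set_val.
apply: (connected_01_const kA' (@coord_continuous _ _ hT e)).
- move=> _ [p Ap <-]; apply: (ec_out (coordP hT e)).
  rewrite inner_image => -[t t01 tp]; apply: (Ae _ Ap).
  by exists (exist _ e se), t; split=> //; exact: val_inj.
- by exists (exist _ u (mem_set (@spine_l _ _ u v))).
- by exists (exist _ v (mem_set (@spine_r _ _ u v))).
Qed.

Section Uniqueness.
Variables (u v : T) (P : set T).
Hypothesis hP : pseudo_arc_in u v P.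

Let vu : vtx T u. Proof. by case: hP => a [b [<- _ [_ _ _ []]]]. Qed.
Let vv : vtx T v. Proof. by case: hP => a [b [_ <- [_ _ _ []]]]. Qed.
Let Pu : P u. Proof. by case: hP => a [b [<- _ _]]; exact: set_valP. Qed.
Let Pv : P v. Proof. by case: hP => a [b [_ <- _]]; exact: set_valP. Qed.

Let imP : set_val @` [set: P] = P.
Proof.
apply/seteqP; split=> [_ [p _ <-]|p Pp]; first exact: set_valP.
by exists (exist _ p (mem_set Pp)).
Qed.

Let cP : compact P.
Proof.
rewrite -imP; apply: continuous_compact; last by case: hP => a [b [_ _ []]].
by apply: continuous_subspaceT; exact: continuous_set_val.
Qed.

Let clP : closed P.
Proof. by apply: compact_closed => //; exact: gl_hausdorff. Qed.

Let kP : connected P.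
Proof.
rewrite -imP; apply: connected_continuous_connected.
  by case: hP => a [b [_ _ []]].
by apply: continuous_subspaceT; exact: continuous_set_val.
Qed.

Let edgeP e t : open01 t -> P (iota T e t) -> forall t', P (iota T e t').
Proof.
move=> t01 Pt; have [a [b [_ _ [gP _ _ _ _]]]] := hP.
have [|[f Sf] [s [s01 /(congr1 set_val) /= fs]]] :=
    @not_vtx_inner _ _ gP (exist _ (iota T e t) (mem_set Pt)).
  by move=> /(vtx_not_inner hG (F := setT)); apply; exists e, t.
by have [<- _] := gl_inj hG s01 t01 fs.
Qed.

(** Let [e] not separate [u] from [v]. If [P] had an inner point of [e], then [e] would be an edge
    of [P], and by [connected_side] the part of [P] on the side of [u] would join [u] to [v] in
    [P - e]. So [coord e] is constant on [P]. *)
Lemma pseudo_arc_sub_spine : P `<=` spine u v.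
Proof.
move=> p Pp e uv.
have nPe q : P q -> ~ inner [set e] q.
  rewrite inner_image => Pq [t t01 tq].
  have Pe : forall t', P (iota T e t') by apply: (@edgeP e t) => //; rewrite tq.
  have [a [b [au bv [_ _ _ _ /(_ (exist _ e Pe)) nc]]]] := hP; apply: nc.
  have [c uc] := coord_vtx hT e vu.
  exists (set_val @^-1` [set q | coord e q = c%:R]); last by rewrite /= bv -uv uc.
  split; first by rewrite /= au uc.
    move=> x /= xc [_ [s [-> s01 /(congr1 set_val) /= sx]]].
    by move: xc; rewrite -sx; exact: open01_coord.
  apply: connected_set_type.
  rewrite (_ : _ @` _ = P `&` [set q | coord e q = c%:R]); first exact: connected_side.
  apply/seteqP; split=> [_ [x xc <-]|x [Px xc]].
    by split=> //; exact: set_valP.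
  by exists (exist _ x (mem_set Px)).
apply: (connected_01_const kP (@coord_continuous _ _ hT e)) => // q Pq.
by apply: (ec_out (coordP hT e)); exact: nPe.
Qed.

(** If an inner point of [e] is in the spine, [e] separates [u] from [v]. Then [coord e] takes all
    values in [0, 1] on the connected [P], and a value strictly between 0 and 1 determines the
    point. *)
Let spine_diff q : spine u v q -> ~ P q -> vtx T q.
Proof.
move=> sq nPq; apply: contrapT => /(not_vtx_inner hG)[e [t [t01 tq]]].
apply: nPq; move: sq; rewrite -tq => sq.
have nuv := spine_inner hT vu t01 sq.
have : connected (coord e @` P).
  apply: connected_continuous_connected => //.
  by apply: continuous_subspaceT; exact: coord_continuous.
move=> /connected_intervalP ic.
have [x [y [Px Py x0 y1]]] : exists x y, [/\ P x, P y, coord e x = 0 & coord e y = 1].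
  move: nuv; have [b ub] := coord_vtx hT e vu; have [c vc] := coord_vtx hT e vv.
  rewrite ub vc; case: b c ub vc => -[]// ub vc _; first by exists v, u.
  by exists u, v.
have [|||z Pz zt] := ic 0 1 _ _ (set_val t).
- by exists x.
- by exists y.
- by move: t01; rewrite /open01 /= => /andP[? ?]; rewrite !ltW.
have [|s [s01 zs]] := @coord_inner _ _ hT e z; first by rewrite zt.
by rewrite zt => /val_inj ->; rewrite -zs.
Qed.

Lemma spine_sub_pseudo_arc : spine u v `<=` P.
Proof.
move=> q sq; apply: contrapT => nPq; have vq := spine_diff sq nPq.
(* By [gl_sep] the members of [D] have no vertex other than [q] in common, so by compactness a
   single [V] contains all vertices of [P]. *)
pose D := [set A : set T | exists U V : set T, [/\ open U, open V, U `&` V = set0,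
  vtx T `<=` U `|` V & U q /\ A = ~` V]].
have cV : closed (vtx T).
  rewrite (_ : vtx T = ~` inner setT); first exact/open_closedC/open_inner.
  apply/seteqP; split=> p; first exact: vtx_not_inner.
  have : [set: T] p by []; rewrite -(gl_cover hG) => -[//|ip] /(_ ip) [].
have cPV : compact (P `&` vtx T).
  by apply: (subclosed_compact _ cP); [exact: closedI|move=> ? []].
have [|||||_ [U [V [oU oV UV0 VUV [Uq ->]]]] PVV] := @compact_directed_sub T _ D set0 cPV.
- by exists setT, set0; split; rewrite ?setI0 ?setC0 ?setU0 //; [exact: openT|exact: open0].
- move=> _ _ [U [V [oU oV UV0 VUV [Uq ->]]]] [U' [V' [oU' oV' UV'0 VUV' [U'q ->]]]].
  exists (U `&` U'), (V `|` V'); split.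
  + exact: openI.
  + exact: openU.
  + apply/seteqP; split=> // x [[Ux U'x] [Vx|V'x]].
      by have : (U `&` V) x by []; rewrite UV0.
    by have : (U' `&` V') x by []; rewrite UV'0.
  + move=> x vx; case: (VUV x vx) => Ux; last by right; left.
    by case: (VUV' x vx) => U'x; [left|right; right].
  + by rewrite setCU.
- by move=> _ [U [V [_ oV _ _ [_ ->]]]]; exact: open_closedC.
- exact: open0.
- move=> x [[Px vx] Dx].
  have qx : q <> x by move=> qx; apply: nPq; rewrite qx.
  have [U [V [oU oV UV0 VUV [Uq Vx]]]] := gl_sep hG vq vx qx.
  have : (~` V) x by apply: Dx; exists U, V.
  by apply.
(* Missing points are vertices, so the spine is split by the open sets [U] minus [P] and [V] with
   all inner points. It contains [q] in the first, but [u] is in [P]. *)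
have : spine u v `<=` U `&` ~` P.
  apply: (@connected_sub_open _ _ _ (V `|` inner setT) (@connected_spine _ _ hT u v vu)).
  - by apply: openI => //; exact: closed_openC.
  - by apply: openU => //; exact: open_inner.
  - move=> x sx; have [vx|nvx] := pselect (vtx T x); last first.
      have [e [t [t01 tx]]] := not_vtx_inner hG nvx.
      by right; right; exists e, t.
    have [Px|nPx] := pselect (P x).
      by right; left; apply: contrapT => nVx; apply: (PVV x).
    by case: (VUV x vx) => ?; [left|right; left].
  - apply/seteqP; split=> // x [[sx [Ux nPx]]].
    case=> [Vx|]; first by have : (U `&` V) x by []; rewrite UV0.
    exact: (vtx_not_inner hG (spine_diff sx nPx)).
  - by exists q.
by move=> /(_ u (@spine_l _ _ u v)) [].
Qed.

End Uniqueness.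

(** [spine u v] is a pseudo-arc, so [xget] does not return its default, and whichever pseudo-arc it
    returns equals the spine. *)
Lemma parcE u v : vtx T u -> vtx T v -> parc u v = spine u v.
Proof.
move=> vu vv.
have hP : pseudo_arc_in u v (parc u v).
  by apply: xgetPex; exists (spine u v); exact: spine_pseudo_arc.
apply/seteqP; split.
- exact: pseudo_arc_sub_spine.
- exact: spine_sub_pseudo_arc.
Qed.

End PseudoArcs.

(** * The order of the edge tree set *)

Section EdgeOrder.
Variables (R : realType) (T : gspace R).
Hypothesis hT : tree_like T.
Implicit Types (e f : edge T) (u v p : T) (b c : bool).

Let hG : graph_like T. Proof. by case: hT. Qed.

Definition oedge e b : T * T := (eend e b, eend e (~~ b)).

Lemma coord_eend_const e f b c : e <> f ->
  coord e (eend f b) = coord e (eend f c).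
Proof. exact: coord_const. Qed.

Lemma oedge_inj e f b c : oedge e b = oedge f c -> e = f /\ b = c.
Proof.
move=> [be nbe]; have ef : e = f.
  apply: contrapT => ef; have := coord_eend_const c (~~ c) ef.
  by rewrite -be -nbe !coord_end// => /natb_inj; case: (b).
split=> //; move: be => /(congr1 (coord e)).
by rewrite -ef !coord_end// => /natb_inj.
Qed.

(** Forwards, the first inclusion is tested at the head of [e] with the edge [e], the second at the
    tail of [f] with the edge [f]. Backwards, every edge that constrains the larger spine also
    constrains the smaller one. *)
Lemma tau_lt_oedge e f b c : tau_lt (oedge e b) (oedge f c) <->
  [/\ e <> f, coord e (eend f c) = (~~ b)%:R & coord f (eend e b) = c%:R].
Proof.
rewrite /tau_lt /oedge /= !(parcE hT); do ?exact: eend_vtx.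
split=> [[ef yxv xvw]|[ef ve xf]].
  split.
  - move=> eqf; apply: ef; rewrite eqf.
    by case: b c {yxv xvw} => -[]//=; rewrite setUC.
  - have [d vd] := coord_vtx hT e (eend_vtx hG f c).
    rewrite vd; congr (_%:R); apply: contrapT => db.
    have {}db : d = b by case: d b db {vd yxv xvw ef} => -[].
    have : coord e (eend e b) = coord e (eend f c) by rewrite vd coord_end// db.
    move=> /(yxv _ (@spine_l _ _ _ _) e); rewrite !coord_end// => /natb_inj.
    by case: (b).
  - have [d xd] := coord_vtx hT f (eend_vtx hG e b).
    rewrite xd; congr (_%:R); apply: contrapT => dc.
    have {}dc : d = ~~ c by case: d c dc {xd yxv xvw ef} => -[].
    have : coord f (eend e b) = coord f (eend f (~~ c)) by rewrite xd coord_end// dc.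
    move=> /(xvw _ (@spine_r _ _ _ _) f); rewrite xd coord_end// => /natb_inj.
    by rewrite dc; case: (c).
(* [e] separates its own tail from [f], so an edge not separating the two is not [e] and has both
   ends of [e] on one side; [ngf] is the mirror image. *)
have nef g : coord g (eend e b) = coord g (eend f c) -> g <> e.
  by move=> + ge; rewrite ge ve coord_end// => /natb_inj; case: (b).
have ngf g : coord g (eend e b) = coord g (eend f (~~ c)) -> g <> f.
  by move=> + ge; rewrite ge xf coord_end// => /natb_inj; case: (c).
split.
- have ek := coord_eend_const c (~~ c) ef.
  have eb : coord e (eend e b) <> coord e (eend e (~~ b)).
    by rewrite !coord_end// => /natb_inj; case: (b).
  move=> eqs; apply: eb.
  have xin : [set eend f c; eend f (~~ c)] (eend e b) by rewrite -eqs; left.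
  have yin : [set eend f c; eend f (~~ c)] (eend e (~~ b)) by rewrite -eqs; right.
  by case: xin => ->; case: yin => ->.
- move=> p sp g xv; have xy := coord_eend_const b (~~ b) (nef g xv).
  by rewrite xy; apply: sp; rewrite -xy.
- move=> p sp g xw; have vw := coord_eend_const c (~~ c) (ngf g xw).
  by apply: sp; rewrite vw.
Qed.

End EdgeOrder.

(** * Minors *)

Section MinorMap.
Variables (R : realType) (T1 T2 : gspace R).
Hypothesis hT2 : tree_like T2.

Let hG2 : graph_like T2. Proof. by case: hT2. Qed.

(* Collapsing all of [T2] along [coord e] is a competitor in the definition of
   the contraction, so [coord e] descends to [T2 / F] when [e] is not in [F]. *)
Lemma contract_coord (F : set (edge T2)) e p q : ~ F e ->
  contract_equiv F p q -> coord e p = coord e q.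
Proof.
move=> nFe.
have ker : equiv_class_of (fun p q : T2 => coord e p == coord e q).
  by split=> [x|x y|y x z /eqP -> //]; [exact: eqxx|exact: eq_sym].
pose r := EquivRelPack ker; pose Q := quotient_topology {eq_quot r}.
have rE x y : x = y %[mod Q] -> coord e x = coord e y.
  by move=> /(@eqmodP _ r)/eqP.
have cc : continuous ((coord e \o repr) : Q -> R).
  apply: (@repr_comp_continuous _ _ R); first exact: coord_continuous.
  by move=> x y /eqP/rE ->.
suff : collapsing F r by move=> hr /asboolP /(_ r hr) /eqP.
split=> [f t t' Ff|]; first by apply/eqP/coord_const => // ef; apply: nFe; rewrite ef.
(* The quotient by the kernel maps injectively and continuously to [R], which makes it Hausdorff. *)
have := @Rhausdorff R; rewrite !open_hausdorff => hR x y xy.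
have [|[A B] /= [Ax By] [oA oB AB]] := hR (coord e (repr x)) (coord e (repr y)).
  apply: contra xy => /eqP h; rewrite -(reprK x) -(reprK y).
  by apply/eqP/(@eqmodP _ r)/eqP.
exists ((coord e \o repr) @^-1` A, (coord e \o repr) @^-1` B) => /=.
  by move: Ax By; rewrite !inE.
move/continuousP: cc => cc; split; [exact: cc|exact: cc|].
by rewrite -preimage_setI (eqP AB) preimage_set0.
Qed.

(** [k] picks a representative in [T2] of each point of the minor. It need not be continuous, but
    its composites with coordinates of uncontracted edges are, as these are constant on classes. *)
Lemma minor_map : minor T1 T2 -> exists (k : T1 -> T2) (F : set (edge T2)),
  [/\ injective k, forall e, ~ F e -> continuous (coord e \o k),
      forall p e, vtx T1 p -> ~ F e -> exists b : bool, coord e (k p) = b%:R &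
      forall p, ~ vtx T1 p -> exists e t,
        [/\ ~ F e, open01 t & k p = iota T2 e t]].
Proof.
move=> [F [F2 [_ [W [_ _ [f [g [fK _ cf _ fV]]]]]]]].
pose Q := quotient_topology {eq_quot contract_equiv F}.
pose h (p : T1) : Q := set_val (set_val (f p)).
have hV p : vtx T1 p <-> ((\pi_Q : T2 -> Q) @` vtx T2) (h p).
  split=> [vp|vhp].
    have : [set f x | x in vtx T1] (f p) by exists p.
    by rewrite fV.
  have : [set f x | x in vtx T1] (f p) by rewrite fV.
  by move=> [x vx /(can_inj fK) <-].
have ch : continuous h.
  move=> p; apply: (@continuous_comp _ _ _ (fun x => set_val (f x)) set_val).
    apply: (@continuous_comp _ _ _ f set_val); first exact: cf.
    exact: (@continuous_set_val _ (~` W)).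
  exact: (@continuous_set_val (contract F) _).
have hinj : injective h by move=> p q /val_inj /val_inj /(can_inj fK).
have hk p : \pi_Q (repr (h p)) = h p by rewrite reprK.
exists (fun p => repr (h p)), F; split.
- by move=> p q /(congr1 \pi_Q); rewrite !hk => /hinj.
- move=> e nFe p; apply: (@continuous_comp _ _ _ h (coord e \o repr)); first exact: ch.
  apply: (@repr_comp_continuous _ _ R); first exact: coord_continuous.
  by move=> x y /eqP /(@eqmodP _ (contract_equiv F)) /(contract_coord nFe) ->.
(* The representative of a class of vertices need not be a vertex, but it shares its coordinate with
   the vertex [x] of its class. *)
- move=> p e /hV [x vx xp] nFe.
  have -> : coord e (repr (h p)) = coord e x.
    by apply: (contract_coord nFe); apply/(@eqmodP _ (contract_equiv F)); rewrite hk -xp.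
  exact: coord_vtx.
(* An inner point of a contracted edge is identified with an end of this edge, so its class would be
   a vertex. *)
- move=> p nvp; have nV : ~ vtx T2 (repr (h p)).
    by move=> v; apply/nvp/hV; exists (repr (h p)).
  have [e [t [t01 tp]]] := not_vtx_inner hG2 nV.
  exists e, t; split=> // Fe; apply/nvp/hV.
  exists (iota T2 e i0); first exact: gl_end0.
  rewrite -(hk p) -tp; apply/(@eqmodP _ (contract_equiv F)).
  by have [+ _] := contract_equiv_collapsing F; apply.
Qed.

End MinorMap.

(** * Images of the edges of the minor in the larger space *)

Lemma I01_ivt (R : realType) (g : I01 R -> R) (a b : I01 R) x :
  continuous g -> set_val a <= set_val b ->
  (g a <= x <= g b) || (g b <= x <= g a) ->
  exists2 c, set_val a <= set_val c <= set_val b & g c = x.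
Proof.
move=> cg ab gx; pose A := [set t : I01 R | set_val t \in `[set_val a, set_val b]].
have : connected (g @` A).
  apply: connected_continuous_connected; last exact: continuous_subspaceT.
  apply: connected_I01 => y; rewrite /I01 /= !in_itv /= => /andP[ay yb].
  have /andP[a0 _] := I01P a; have /andP[_ b1] := I01P b.
  by rewrite (le_trans a0 ay) (le_trans yb b1).
move=> /connected_intervalP ig.
have Aa : (g @` A) (g a) by exists a => //; rewrite /A /= in_itv /= lexx ab.
have Ab : (g @` A) (g b) by exists b => //; rewrite /A /= in_itv /= lexx ab.
have [c Ac <-] : (g @` A) x by case/orP: gx; exact: ig.
by exists c => //; move: Ac; rewrite /A /= in_itv.
Qed.

Section EdgeMap.
Variables (R : realType) (T1 T2 : gspace R).
Hypotheses (hT1 : tree_like T1) (hT2 : tree_like T2).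
Variables (k : T1 -> T2) (F : set (edge T2)).
Hypothesis k_inj : injective k.
Hypothesis k_cont : forall e, ~ F e -> continuous (coord e \o k).
Hypothesis k_vtx : forall p e, vtx T1 p -> ~ F e ->
  exists b : bool, coord e (k p) = b%:R.
Hypothesis k_inner : forall p, ~ vtx T1 p ->
  exists e t, [/\ ~ F e, open01 t & k p = iota T2 e t].

Let hG1 : graph_like T1. Proof. by case: hT1. Qed.
Let hG2 : graph_like T2. Proof. by case: hT2. Qed.

Section OneEdge.
Variables (e1 : edge T1) (e2 : edge T2).
Hypothesis nFe2 : ~ F e2.
Let g t := coord e2 (k (iota T1 e1 t)).

Let g_cont : continuous g.
Proof.
move=> t; apply: (@continuous_comp _ _ _ (iota T1 e1) (coord e2 \o k)).
  exact: gl_cont.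
exact: k_cont.
Qed.

Let not_vtx t : open01 t -> ~ vtx T1 (iota T1 e1 t).
Proof. by move=> t01 /(vtx_not_inner hG1 (F := setT)); apply; exists e1, t. Qed.

(** The open interval is covered by the disjoint open sets [B e] over the uncontracted edges, so by
    connectedness it lies in one of them. *)
Lemma inner_to_inner t0 : open01 t0 -> 0 < g t0 < 1 ->
  forall t, open01 t -> 0 < g t < 1.
Proof.
move=> t001 gt0.
pose B e := [set t | 0 < coord e (k (iota T1 e1 t)) < 1].
have oB e : ~ F e -> open (B e).
  move=> nFe.
  have /continuousP c : continuous ((coord e \o k) \o iota T1 e1).
    move=> t; apply: continuous_comp; [exact: gl_cont|exact: k_cont].
  rewrite (_ : B e = ((coord e \o k) \o iota T1 e1) @^-1` `]0, 1[%classic).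
    by apply: c; exact: itv_open.
  by apply/seteqP; split=> t; rewrite /B /= in_itv.
suff : open01 `<=` B e2 by [].
apply: (@connected_sub_open _ _ _ (\bigcup_(e in [set e | e <> e2 /\ ~ F e]) B e)
  (@connected_open01 R)).
- exact: oB.
- by apply: bigcup_open => e [_ nFe]; exact: oB.
- move=> t t01; have [e [s [nFe s01 ks]]] := k_inner (not_vtx t01).
  have Be : B e t by rewrite /B /= ks coord_iota.
  have [ee2|ne] := pselect (e = e2); first by left; rewrite -ee2.
  by right; exists e.
- apply/seteqP; split=> // t [[_ Be2] [e [ne _] Be]].
  have [s [s01 ks _]] := coord_inner hT2 Be.
  have [s' [s'01 ks' _]] := coord_inner hT2 Be2.
  by apply: ne; move: ks'; rewrite ks => /(gl_inj hG2 s01 s'01) [].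
- by exists t0.
Qed.

Hypothesis g01 : forall t, open01 t -> 0 < g t < 1.

Let g_inj t t' : open01 t -> open01 t' -> g t = g t' -> t = t'.
Proof.
move=> t01 t'01 gtt'.
have [s [_ ks gs]] := coord_inner hT2 (g01 t01).
have [s' [_ ks' gs']] := coord_inner hT2 (g01 t'01).
have ss' : s = s' by apply: val_inj; rewrite -[LHS]gs -[RHS]gs'.
by move: ks; rewrite ss' -ks' => /k_inj /(gl_inj hG1 t01 t'01) [].
Qed.

Let g_end (b : bool) : exists c : bool, coord e2 (k (eend e1 b)) = c%:R.
Proof. by apply: k_vtx => //; exact: eend_vtx. Qed.

(** If both ends had the same value, [g] would repeat a value on the two sides of the midpoint [h],
    against [g_inj]. *)
Let g_ends (c d : bool) : g i0 = c%:R -> g i1 = d%:R -> d = ~~ c.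
Proof.
move=> g0 g1; apply: contrapT => dc.
have {dc} dc : d = c by case: d c dc {g0 g1} => -[].
rewrite {}dc in g1.
have [h h01 _] := open01_half R; have /andP[gh0 gh1] := g01 h01.
(* Strictly between the common end value and [g h], hence attained before and after [h], but not at
   [h] or an end. *)
pose x := (c%:R + g h) / 2.
have x01 : 0 < x < 1 by rewrite /x; case: (c) => /=; lra.
have xh : x <> g h by rewrite /x; case: (c) => /=; lra.
have xc (b : bool) : x <> b%:R by case: b => /= ?; lra.
have op t : g t = x -> open01 t.
  by have [->|->|//] := I01_cases t; rewrite ?g0 ?g1 => /esym/xc.
have /andP[h0 h1] := I01P h.
have [||t /andP[_ th] gt] := @I01_ivt _ g i0 h x g_cont.
- by [].
- by rewrite g0 /x; case: (c) => /=; lra.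
have [||t' /andP[ht' _] gt'] := @I01_ivt _ g h i1 x g_cont.
- by [].
- by rewrite g1 /x; case: (c) => /=; lra.
have tt' : t = t' by apply: g_inj; [exact: op|exact: op|rewrite gt].
have : t = h by apply/val_inj/eqP; rewrite eq_le th /= tt' ht'.
by move=> te; apply: xh; rewrite -te gt.
Qed.

Lemma inner_onto t' : open01 t' ->
  exists2 t, open01 t & k (iota T1 e1 t) = iota T2 e2 t'.
Proof.
move=> t'01; have [c g0] := g_end false; have [d g1] := g_end true.
have dc := g_ends g0 g1; have /andP[t'0 t'1] := t'01.
have [||t _ gt] := @I01_ivt _ g i0 i1 (set_val t') g_cont.
- exact: ler01.
- rewrite /g -/(eend e1 false) -/(eend e1 true) g0 g1 dc.
  by case: (c) => /=; rewrite (ltW t'0) (ltW t'1) ?orbT.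
have t01 : open01 t.
  have [te|te|//] := I01_cases t; move: gt; rewrite te /g -(coord_iota hT2 e2).
    by rewrite -/(eend e1 false) g0 => /esym /(open01_coord hT2 t'01).
  by rewrite -/(eend e1 true) g1 => /esym /(open01_coord hT2 t'01).
exists t => //; have [s [_ ks gs]] := coord_inner hT2 (g01 t01).
by rewrite ks; have -> : s = t' by apply: val_inj; rewrite -[LHS]gs -[RHS]gt.
Qed.

(** Only inner points of [e1] are mapped into [e2], by [inner_onto] and injectivity. So on each
    connected side of [e1] the coordinate of [e2] is constant and can be read off at an end; [s]
    says whether [k] reverses the edge. *)
Lemma coord_transfer : exists s : bool, forall p (b : bool), coord e1 p = b%:R ->
  coord e2 (k p) = (s (+) b)%:R.
Proof.
have [c g0] := g_end false; have [d g1] := g_end true.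
have dc := g_ends g0 g1; exists c => p b pb.
have <- : coord e2 (k (eend e1 b)) = (c (+) b)%:R.
  by case: b {pb}; rewrite ?g0 ?g1 ?dc ?addbT ?addbF.
apply: (connected_01_const (@ec_conn _ _ _ _ (coordP hT1 e1) b) (@k_cont e2 nFe2)) => //.
  move=> q qb; apply: (ec_out (coordP hT2 e2)).
  rewrite inner_image => -[t' t'01 kq].
  have [t t01 kt] := inner_onto t'01.
  have tq : iota T1 e1 t = q by apply: k_inj; rewrite kt.
  by move: qb => /=; rewrite -tq; exact: open01_coord.
by rewrite /= coord_end.
Qed.

End OneEdge.

Lemma edge_image e1 : exists (es : edge T2 * bool),
  [/\ forall t, open01 t ->
        exists2 t', open01 t' & k (iota T1 e1 t) = iota T2 es.1 t',
      forall t', open01 t' ->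
        exists2 t, open01 t & k (iota T1 e1 t) = iota T2 es.1 t' &
      forall p (b : bool), coord e1 p = b%:R -> coord es.1 (k p) = (es.2 (+) b)%:R].
Proof.
have [h h01 _] := open01_half R.
have [|e2 [s [nF s01 ks]]] := @k_inner (iota T1 e1 h).
  by move=> /(vtx_not_inner hG1 (F := setT)); apply; exists e1, h.
have g01 : forall t, open01 t -> 0 < coord e2 (k (iota T1 e1 t)) < 1.
  by apply: (inner_to_inner nF h01); rewrite ks coord_iota.
have [c hc] := coord_transfer nF g01.
exists (e2, c); split=> //=; last exact: inner_onto.
move=> t t01; have [t' [t'01 kt _]] := coord_inner hT2 (g01 t t01).
by exists t'.
Qed.

Lemma oedge_map : exists (E : edge T1 -> edge T2) (s : edge T1 -> bool),
  injective E /\ forall e f b c,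
  tau_lt (oedge e b) (oedge f c) <->
  tau_lt (oedge (E e) (s e (+) b)) (oedge (E f) (s f (+) c)).
Proof.
have /choice [Es hEs] := edge_image.
pose E e := (Es e).1; pose s e := (Es e).2.
have Einj : injective E.
  move=> e f ef; have [h h01 _] := open01_half R.
  have [_ /(_ h h01) [t t01 kt] _] := hEs e.
  have [_ /(_ h h01) [t' t'01 kt'] _] := hEs f.
  have : k (iota T1 e t) = k (iota T1 f t') by rewrite kt kt' -/(E e) -/(E f) ef.
  by move=> /k_inj /(gl_inj hG1 t01 t'01) [].
exists E, s; split=> //.
(* Ends of [f] need not go to ends of [E f], but inner points go to inner points. So the end is
   replaced by the midpoint of [f], at no change of coordinate. *)
have coordE e f c c' (d : bool) : e <> f -> coord e (eend f c) = d%:R ->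
    coord (E e) (eend (E f) c') = (s e (+) d)%:R.
  move=> ef ed; have [h h01 _] := open01_half R.
  have [/(_ h h01) [t t01 kt] _ _] := hEs f.
  have [_ _ tr] := hEs e.
  rewrite -(tr (iota T1 f h)); last by rewrite -ed; exact: coord_const.
  by rewrite kt; apply: coord_const => // /Einj.
(* The converse holds because the coordinate of an end is a boolean and adding [s e] is
   injective. *)
have iffE e f c c' (d : bool) : e <> f -> coord e (eend f c) = d%:R <->
    coord (E e) (eend (E f) c') = (s e (+) d)%:R.
  move=> ef; split; first exact: coordE.
  have [d' ed'] := coord_vtx hT1 e (eend_vtx hG1 f c).
  rewrite (coordE _ _ _ c' _ ef ed') ed' => /natb_inj.
  by case: (s e) d d' {ed'} => -[] [].
move=> e f b c; rewrite !tau_lt_oedge//; split=> -[ef h1 h2].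
  split; first by move=> /Einj.
    by rewrite -addbN; apply/(iffE e f c).
  by apply/(iffE f e b) => // fe; exact: ef.
have {}ef : e <> f by move=> eqf; apply: ef; rewrite eqf.
have fe : f <> e by move=> eqf; exact: ef.
split=> //.
- by apply/(iffE e f c (s f (+) c)) => //; rewrite addbN.
- exact/(iffE f e b (s e (+) b)).
Qed.

End EdgeMap.

(** * Oriented edges as elements of the edge tree set, and the embedding *)

Section TauElements.
Variables (R : realType) (T : gspace R).

Lemma oedge_ground (e : edge T) b : tau_ground T (oedge e b).
Proof. by exists e; case: b; [right|left]. Qed.

Definition tau_oedge (x : edge T * bool) : tau T :=
  exist _ (oedge x.1 x.2) (mem_set (oedge_ground x.1 x.2)).

Lemma tau_oedge_surj (s : tau T) : exists x, tau_oedge x = s.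
Proof.
have [e es] := set_valP s; case: es => es.
- by exists (e, false); apply: val_inj; exact: esym es.
- by exists (e, true); apply: val_inj; exact: esym es.
Qed.

Lemma tau_oedge_inj : tree_like T -> injective tau_oedge.
Proof.
by move=> hT [e b] [f c] /(congr1 set_val) /(oedge_inj hT) /= [-> ->].
Qed.

Lemma tau_oedge_inv e b : sep_inv (tau_oedge (e, b)) = tau_oedge (e, ~~ b).
Proof. by apply: val_inj; rewrite /= /oedge /= negbK. Qed.

End TauElements.

Theorem theorem4p17 (R : realType) (T1 T2 : gspace R)
    (hT1 : tree_like T1) (hT2 : tree_like T2) (hmin : minor T1 T2) :
  exists (A : set (tau T2)) (hA : inv_closed A),
    sepsys_iso (tau T1) (subsys hA).
Proof.
have [k [F [kinj kcont kvtx kinner]]] := minor_map hT2 hmin.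
have [E [s [Einj Elt]]] := oedge_map hT1 hT2 kinj kcont kvtx kinner.
have /choice [dec decK] := @tau_oedge_surj R T1.
have decE x : dec (tau_oedge x) = x by apply: (tau_oedge_inj hT1); rewrite decK.
(* The orientation is flipped exactly on the edges that [k] reverses. *)
pose phi (x : edge T1 * bool) := (E x.1, s x.1 (+) x.2).
have phi_inj : injective phi.
  by move=> [e b] [f c] [/Einj -> /addbI ->].
pose f (x : tau T1) : tau T2 := tau_oedge (phi (dec x)).
have fE x : f (tau_oedge x) = tau_oedge (phi x) by rewrite /f decE.
have f_inj : injective f.
  by move=> x y /(tau_oedge_inj hT2) /phi_inj e; rewrite -(decK x) -(decK y) e.
have f_inv x : f (sep_inv x) = sep_inv (f x).
  have [[e b] <-] := tau_oedge_surj x.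
  by rewrite tau_oedge_inv !fE /phi tau_oedge_inv addbN.
have f_le x y : sep_le x y <-> sep_le (f x) (f y).
  have lt : tau_lt (set_val x) (set_val y) <-> tau_lt (set_val (f x)) (set_val (f y)).
    have [[e b] <-] := tau_oedge_surj x; have [[e' b'] <-] := tau_oedge_surj y.
    by rewrite !fE; exact: Elt.
  (* [sep_le] includes equality, which is reflected by injectivity of [f]. *)
  split=> -[xy|/lt ?]; [by left; rewrite xy|by right|by left; exact: f_inj|by right].
have hA : inv_closed (range f).
  by move=> _ [x _ <-]; exists (sep_inv x) => //; rewrite f_inv.
exists (range f), hA.
pose f' (x : tau T1) : subsys hA := exist _ (f x) (imageT f x).
have /choice [g fg] : forall y : subsys hA, exists x, f x = proj1_sig y.
  by move=> y; have [x _ xy] := proj2_sig y; exists x.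
have g_inv y : g (sep_inv y) = sep_inv (g y).
  by apply: f_inj; rewrite fg f_inv fg.
exists f', g; split.
- by move=> x; apply: f_inj; rewrite fg.
- by move=> y; apply: eq_sig_hprop => [x|]; [exact: Prop_irrelevance|exact: fg].
- by move=> x y /f_le.
- by move=> x y xy; apply/f_le; rewrite !fg.
- split=> // x; apply: eq_exist; exact: f_inv.
Qed.
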